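(* For every integer $n\ge 7$, the matrix $C_n$ is $(k-1,k-1,1)$-coverable for $k=\sigma(n)$. In particular, for all integers $n,m\ge 7$, $\mathrm{R}_{\mathbb{B}}(C_n\otimes C_m)<\mathrm{R}_{\mathbb{B}}(C_n)\cdot\mathrm{R}_{\mathbb{B}}(C_m)$.
   Context: $C_n$ is the $n\times n$ $0,1$-matrix with zeros on the diagonal and ones elsewhere. $\sigma(n)=\min\{k : n\le\binom{k}{\lceil k/2\rceil}\}$. The Boolean rank $\mathrm{R}_{\mathbb{B}}(A)$ of a $0,1$-matrix is the smallest number of all-ones combinatorial rectangles needed to cover its $1$-entries. A collection of $0,1$-matrices covers $A$ if $A_{i,j}=1$ iff some matrix of the collection has a $1$ in entry $(i,j)$. $A$ is $(a_1,a_2,a_3)$-coverable if there exist three matrices $A_1,A_2,A_3$ with $\mathrm{R}_{\mathbb{B}}(A_i)\le a_i$ for all $i$ such that every two of them cover $A$. The Kronecker product $A\otimes B$ is the block matrix with $(i,j)$-th block $A_{i,j}B$. *)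

(* Defs.v *)
From mathcomp Require Import all_boot all_order all_algebra.
From mathcomp Require Import mxtens.

Set Implicit Arguments.
Unset Strict Implicit.
Unset Printing Implicit Defensive.

(* 0,1-matrices are matrices over bool, with true standing for 1. The product
   of the ring structure on bool is conjunction, so that the Kronecker product
   A *t B from mxtens is the one of 0,1-matrices. The addition of that ring is
   exclusive or; it is used nowhere below. *)

Definition cmx (n : nat) : 'M[bool]_n := \matrix_(i, j) (i != j).

Lemma sigma_ex (n : nat) : exists k, n <= 'C(k, uphalf k).
Proof.
exists n.*2; rewrite uphalf_double.
elim: n => // n IHn; rewrite doubleS !binS.
have lt0 : 0 < 'C(n.*2, n.+1) + 'C(n.*2, n).
  by rewrite addn_gt0 orbC bin_gt0 -addnn leq_addr.
have lt1 : n <= 'C(n.*2, n) by [].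
rewrite -addn1 addnC leq_add // (leq_trans lt1) //.
by case: n {IHn lt0 lt1} => // n; rewrite binS leq_addr.
Qed.

Definition sigma (n : nat) : nat := ex_minn (sigma_ex n).

Section BooleanRank.

Variables m n : nat.

Definition rectangle : Type := ({set 'I_m} * {set 'I_n})%type.

Definition ones_rectangle (A : 'M[bool]_(m, n)) (r : rectangle) : bool :=
  [forall i in r.1, forall j in r.2, A i j].

Definition rectangle_cover (A : 'M[bool]_(m, n)) (F : {set rectangle}) : bool :=
  [forall r in F, ones_rectangle A r] &&
  [forall i, forall j, A i j ==> [exists r in F, (i \in r.1) && (j \in r.2)]].

Lemma rectangle_cover_ex (A : 'M[bool]_(m, n)) :
  exists k, [exists F : {set rectangle}, rectangle_cover A F && (#|F| == k)].
Proof.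
exists #|[set r | ones_rectangle A r]|; apply/existsP.
exists [set r | ones_rectangle A r]; rewrite eqxx andbT; apply/andP; split.
  by apply/forall_inP => r; rewrite inE.
apply/forallP => i; apply/forallP => j; apply/implyP => Aij.
apply/existsP; exists ([set i], [set j]); rewrite !inE !eqxx !andbT.
by apply/forall_inP => i' /set1P ->; apply/forall_inP => j' /set1P ->.
Qed.

Definition brank (A : 'M[bool]_(m, n)) : nat := ex_minn (rectangle_cover_ex A).

Definition covers (s : seq 'M[bool]_(m, n)) (A : 'M[bool]_(m, n)) : Prop :=
  forall i j, A i j <-> (exists2 B, B \in s & B i j).

Definition coverable (a1 a2 a3 : nat) (A : 'M[bool]_(m, n)) : Prop :=
  exists A1 A2 A3 : 'M[bool]_(m, n),
    [/\ brank A1 <= a1, brank A2 <= a2 & brank A3 <= a3] /\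
    [/\ covers [:: A1; A2] A, covers [:: A1; A3] A & covers [:: A2; A3] A].

End BooleanRank.

(* Main.v *)
Require Import Defs.
From mathcomp Require Import all_boot all_order all_algebra.
From mathcomp Require Import mxtens.
From mathcomp Require Import zify.

Set Implicit Arguments.
Unset Strict Implicit.
Unset Printing Implicit Defensive.

(** Indexing a cover of [cmx n] by [k] rectangles with a [k]-set attaches to the
   rows pairwise incomparable subsets of that set, so Sperner's theorem gives
   [sigma n <= brank (cmx n)].

   With [m = sigma n - 1] rectangles, label the rows injectively by subsets of
   an [m]-set [T] from the levels [h] and [h + 1], where [h + 1 = uphalf m].
   The non-inclusion matrix of the labelling misses only inclusions from the
   lower level into the upper one, and these lie in a single rectangle. A second
   labelling permutes the upper level by some [rho] with [#|A :&: rho A| < h],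
   so that no 1-entry is missed twice. For [rho A], take the middle element of
   the chain of [~: A] in a symmetric chain decomposition of the subsets of [T],
   which also proves Sperner's theorem.

   Each 1-entry of a coverable matrix lies in two of its three parts. Hence
   [A1 *t B1], [A2 *t B3] and [A3 *t B2] cover [A *t B]. For [cmx n *t cmx m],
   with [k = sigma n] and [l = sigma m], this takes at most
   [(k - 1) * (l - 1) + (k - 1) + (l - 1) = k * l - 1] rectangles. *)

(** * Symmetric chains *)

Section SymmetricChains.

Variable T : finType.
Implicit Types A B C D X : {set T}.

Lemma setD1_notin A x : x \notin A -> A :\ x = A.
Proof. by move=> xA; apply/setDidPl; rewrite disjoint_sym disjoints1. Qed.

Lemma subsetU1P A D x :
  reflect (exists2 B : {set T}, B \subset D & A = B \/ A = x |: B)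
          (A \subset x |: D).
Proof.
apply: (iffP idP) => [AD|[B BD [->|->]]]; last 2 first.
- exact: subset_trans BD (subsetUr _ _).
- exact: setUS.
exists (A :\ x); first by rewrite subDset.
have [xA|xA] := boolP (x \in A); first by right; rewrite setD1K.
by left; rewrite setD1_notin.
Qed.

Definition nested A B : bool := (A \subset B) || (B \subset A).

Lemma nested_sub A B : nested A B -> #|A| <= #|B| -> A \subset B.
Proof.
by case/orP=> // BA AleB; have /eqP-> : B == A by rewrite eqEcard BA.
Qed.

Section Partition.

Variables (K : eqType) (D : {set T}) (chain : {set T} -> K).

Definition meets_level (k : K) (s : nat) : Prop :=
  exists A, [/\ A \subset D, chain A = k & #|A| = s].

(* The chains are the fibres of [chain] on the subsets of [D]. *)
Definition symmetric_chains : Prop :=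
  [/\ forall A B, A \subset D -> B \subset D -> chain A = chain B -> nested A B,
      forall A, A \subset D -> meets_level (chain A) (#|D| - #|A|)
    & forall A B s, A \subset D -> B \subset D -> chain A = chain B ->
        #|A| <= s <= #|B| -> meets_level (chain A) s].

Definition below_top A : bool :=
  [exists B : {set T}, [&& B \subset D, chain B == chain A & #|A| < #|B|]].

Lemma below_topP A :
  reflect (exists B, [/\ B \subset D, chain B = chain A & #|A| < #|B|])
          (below_top A).
Proof.
apply: (iffP existsP) => -[B].
  by case/and3P=> BD /eqP cB AB; exists B.
by case=> BD cB AB; exists B; rewrite BD cB eqxx.
Qed.

Hypothesis chainP : symmetric_chains.

Lemma sub_top A B : A \subset D -> B \subset D -> chain A = chain B ->
  ~~ below_top B -> A \subset B.
Proof.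
have [nest _ _] := chainP; move=> AD BD cAB /below_topP topB.
apply: nested_sub (nest A B AD BD cAB) _; rewrite leqNgt.
by apply/negP=> ltBA; apply: topB; exists A.
Qed.

Lemma meets_level_succ A : A \subset D -> below_top A ->
  meets_level (chain A) #|A|.+1.
Proof.
have [_ _ saturated] := chainP; move=> AD /below_topP[B [BD cB AB]].
by apply: (saturated A B) => //; rewrite leqnSn.
Qed.

Lemma meets_level_between A s : A \subset D ->
  minn #|A| (#|D| - #|A|) <= s <= maxn #|A| (#|D| - #|A|) ->
  meets_level (chain A) s.
Proof.
have [_ symmetric saturated] := chainP.
move=> AD; have [B [BD cB <-]] := symmetric A AD.
have [_|_] := leqP #|A| #|B|; first exact: saturated.
by rewrite -cB; apply: saturated.
Qed.

End Partition.

(* Each chain [A_1 < .. < A_r] in [D] yields the two chains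
   [A_1 < .. < A_r < x |: A_r] and [x |: A_1 < .. < x |: A_(r - 1)]. *)
Definition chain_setU1 (K : eqType) (D : {set T}) (chain : {set T} -> K)
    (x : T) (A : {set T}) : bool * K :=
  ((x \in A) && below_top D chain (A :\ x), chain (A :\ x)).

Section ChainsSetU1.

Variables (K : eqType) (D : {set T}) (chain : {set T} -> K) (x : T).
Hypotheses (chainP : symmetric_chains D chain) (xD : x \notin D).

Local Notation chain' := (chain_setU1 D chain x).

Let notin_sub A : A \subset D -> x \notin A.
Proof. by move/subsetP => AD; apply: contra xD => /AD. Qed.

Lemma chain_setU1E A : A \subset D ->
  (chain' A = (false, chain A)) *
  (chain' (x |: A) = (below_top D chain A, chain A)).
Proof.
move=> /notin_sub xA; rewrite /chain_setU1 (negPf xA) (setD1_notin xA).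
by rewrite setU11 setU1K.
Qed.

Lemma card_setU1_sub A : A \subset D -> #|x |: A| = #|A|.+1.
Proof. by move=> /notin_sub xA; rewrite cardsU1 xA. Qed.

Lemma meets_level_without k s : meets_level D chain k s ->
  meets_level (x |: D) chain' (false, k) s.
Proof.
case=> A [AD <- <-]; exists A; split; rewrite ?chain_setU1E //.
exact: subset_trans AD (subsetUr _ _).
Qed.

Lemma meets_level_with A : A \subset D ->
  meets_level (x |: D) chain' (below_top D chain A, chain A) #|A|.+1.
Proof.
move=> AD; exists (x |: A).
by rewrite setUS // (chain_setU1E AD) card_setU1_sub.
Qed.

Lemma chain_setU1_nested A B : A \subset x |: D -> B \subset x |: D ->
  chain' A = chain' B -> nested A B.
Proof.
have [nest _ _] := chainP.
case/subsetU1P=> {}A AD [->|->] /subsetU1P[{}B BD [->|->]];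
  rewrite /nested ?(chain_setU1E AD, chain_setU1E BD) => -[].
- exact: nest.
- move=> topB cAB; rewrite (subset_trans _ (subsetUr _ B)) //.
  by apply: (sub_top chainP) => //; rewrite -topB.
- move=> topA cAB; rewrite orbC (subset_trans _ (subsetUr _ A)) //.
  by apply: (sub_top chainP) => //; rewrite topA.
- by move=> _ /(nest _ _ AD BD)/orP[] /(setUS [set x]) ->; rewrite ?orbT.
Qed.

Lemma chain_setU1_symmetric X : X \subset x |: D ->
  meets_level (x |: D) chain' (chain' X) (#|x |: D| - #|X|).
Proof.
have [_ symmetric _] := chainP.
case/subsetU1P=> A AD defX; have AleD := subset_leq_card AD.
have [B [BD cB sB]] := symmetric A AD.
case: defX => ->; rewrite (chain_setU1E AD) !card_setU1_sub //.
  rewrite subSn // -sB -cB; have [belowB|topB] := boolP (below_top D chain B).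
    exact/meets_level_without/meets_level_succ.
  by have := meets_level_with BD; rewrite (negPf topB).
rewrite subSS; have [belowA|topA] := boolP (below_top D chain A); last first.
  by apply: meets_level_without; rewrite -sB; exists B.
have [A1 [A1D cA1 sA1]] := meets_level_succ chainP AD belowA.
have [B1 [B1D cB1 sB1]] := symmetric A1 A1D.
have A1leD := subset_leq_card A1D.
have belowB1 : below_top D chain B1.
  by apply/below_topP; exists B; rewrite cB1 cA1 cB; split=> //; lia.
have := meets_level_with B1D; rewrite belowB1 cB1 cA1.
by congr meets_level; lia.
Qed.

Lemma chain_setU1_saturated A B s : A \subset x |: D -> B \subset x |: D ->
  chain' A = chain' B -> #|A| <= s <= #|B| ->
  meets_level (x |: D) chain' (chain' A) s.
Proof.
have [_ _ saturated] := chainP.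
move=> AD BD cAB /andP[As]; rewrite leq_eqVlt => /orP[/eqP-> | sB].
  by rewrite cAB; exists B.
case/subsetU1P: AD As cAB => {}A AD [] ->;
  case/subsetU1P: BD sB => {}B BD [] ->;
  rewrite ?(chain_setU1E AD, chain_setU1E BD)
    ?(card_setU1_sub AD, card_setU1_sub BD) => sB As [].
- by move=> cAB; apply/meets_level_without/(saturated A B); rewrite // As ltnW.
- by move=> _ cAB; apply/meets_level_without/(saturated A B); rewrite // As.
- move=> topA cAB; case/negP: (negbT topA); apply/below_topP.
  by exists B; split=> //; apply: leq_trans As (ltnW sB).
move=> fAB cAB.
have belowA : below_top D chain A.
  by apply/below_topP; exists B; split=> //; apply: leq_trans As sB.
have [|C [CD cC sC]] := saturated A B s.-1 AD BD cAB; first by lia.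
have belowC : below_top D chain C.
  by apply/below_topP; exists B; rewrite cC cAB; split=> //; lia.
have := meets_level_with CD; rewrite belowC cC belowA sC.
by congr meets_level; lia.
Qed.

Lemma symmetric_chains_setU1 : symmetric_chains (x |: D) chain'.
Proof.
split.
- exact: chain_setU1_nested.
- exact: chain_setU1_symmetric.
- exact: chain_setU1_saturated.
Qed.

End ChainsSetU1.

Lemma symmetric_chains_set0 : symmetric_chains set0 (fun=> tt).
Proof.
split=> [A B|A|A B s]; rewrite ?subset0.
- by move=> /eqP->; rewrite /nested sub0set.
- by move=> /eqP->; exists set0; rewrite !cards0.
- move=> /eqP-> /eqP-> _; rewrite cards0 -eqn_leq => /eqP <-.
  by exists set0; rewrite cards0.
Qed.

Theorem ex_symmetric_chains D :
  exists (K : eqType) (chain : {set T} -> K), symmetric_chains D chain.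
Proof.
have [n] := ubnP #|D|; elim: n D => // n IHn D.
have [-> _|[x xD]] := set_0Vmem D.
  by exists unit, (fun=> tt); apply: symmetric_chains_set0.
rewrite (cardsD1 x) xD ltnS => /IHn[K [chain chainP]].
exists (bool * K)%type, (chain_setU1 (D :\ x) chain x).
rewrite -[X in symmetric_chains X](setD1K xD).
by apply: symmetric_chains_setU1; rewrite ?setD11.
Qed.

Lemma ex_middle_retraction : exists mid : {set T} -> {set T},
  [/\ forall A, #|mid A| = uphalf #|T|,
      forall A B, mid A = mid B -> nested A B
    & forall A, #|A| <= uphalf #|T| -> A \subset mid A].
Proof.
have [K [chain chainP]] := ex_symmetric_chains [set: T].
have ex_mid A : exists B, chain B = chain A /\ #|B| = uphalf #|T|.
  have [||B [_ cB sB]] := @meets_level_between _ _ _ chainP A (uphalf #|T|).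
  - exact: subsetT.
  - by rewrite cardsT; have := max_card A; lia.
  by exists B.
have [mid midP] := fin_all_exists ex_mid.
have [nest _ _] := chainP; exists mid; split=> [A|A B E|A Ah].
- by case: (midP A).
- by apply: nest; rewrite ?subsetT // -(midP A).1 E (midP B).1.
have [cA sA] := midP A; apply: nested_sub; rewrite ?sA //.
by apply: nest; rewrite ?subsetT.
Qed.

Theorem sperner (I : finType) (a : I -> {set T}) :
  (forall i j, a i \subset a j -> i = j) -> #|I| <= 'C(#|T|, uphalf #|T|).
Proof.
have [mid [card_mid mid_nested _]] := ex_middle_retraction => antichain.
have mid_inj : injective (mid \o a).
  by move=> i j /mid_nested/orP[] /antichain.
rewrite -card_draws -cardsT -(card_imset _ mid_inj); apply: subset_leq_card.
by apply/subsetP=> _ /imsetP[i _ ->]; rewrite inE card_mid.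
Qed.

Lemma ex_middle_level_permutation : exists rho : {set T} -> {set T},
  [/\ injective rho, forall A, #|rho A| = #|A|,
      forall A, #|A| != uphalf #|T| -> rho A = A
    & forall A, #|A| = uphalf #|T| -> #|A :&: rho A| = odd #|T|].
Proof.
have [mid [card_mid mid_nested sub_mid]] := ex_middle_retraction.
pose rho A := if #|A| == uphalf #|T| then mid (~: A) else A.
have card_rho A : #|rho A| = #|A| by rewrite /rho; case: eqP => // ->.
exists rho; split=> // [A B E|A /negPf|A cA]; last 2 first.
- by rewrite /rho => ->.
- rewrite /rho cA eqxx -[A in A :&: _]setCK setIC -setDE cardsD.
  have cAC := cardsC A; rewrite (setIidPr (sub_mid _ _)) ?card_mid; lia.
have cAB : #|A| = #|B| by rewrite -card_rho E card_rho.
move: E; rewrite /rho cAB; case: eqP => // _ /mid_nested.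
rewrite /nested !setCS orbC => /nested_sub AB.
by apply/eqP; rewrite eqEcard AB cAB leqnn.
Qed.

End SymmetricChains.

(** * Boolean rank *)

Lemma map2_mxE (R S U : Type) (f : R -> S -> U) m n (A : 'M[R]_(m, n))
    (B : 'M[S]_(m, n)) i j :
  map2_mx f A B i j = f (A i j) (B i j).
Proof. exact: mxE. Qed.

Section BooleanRankTheory.

Variables m n : nat.
Implicit Types A B C : 'M[bool]_(m, n).

Lemma rectangle_coverP A (F : {set rectangle m n}) :
  reflect
    ((forall r, r \in F -> forall i j, i \in r.1 -> j \in r.2 -> A i j) /\
     (forall i j, A i j -> exists2 r, r \in F & (i \in r.1) && (j \in r.2)))
    (rectangle_cover A F).
Proof.
apply: (iffP andP) => -[ones cov]; split.
- move=> r rF i j ir jr.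
  by have /forall_inP/(_ i ir)/forall_inP/(_ j jr) := forall_inP ones r rF.
- move=> i j Aij.
  have /forallP/(_ j)/implyP/(_ Aij)/exists_inP[r] := forallP cov i.
  by exists r.
- apply/forall_inP=> r rF; apply/forall_inP=> i ir; apply/forall_inP=> j jr.
  exact: ones rF _ _ ir jr.
- apply/forallP=> i; apply/forallP=> j; apply/implyP=> /cov[r rF rij].
  by apply/exists_inP; exists r.
Qed.

Lemma brank_le_cover A (F : {set rectangle m n}) :
  rectangle_cover A F -> brank A <= #|F|.
Proof.
rewrite /brank; case: ex_minnP => k _ + coverF; apply.
by apply/existsP; exists F; rewrite coverF /=.
Qed.

Lemma ex_brank_cover A : exists2 F, rectangle_cover A F & #|F| = brank A.
Proof.
by rewrite /brank; case: ex_minnP => k /existsP[F /andP[coverF /eqP]]; exists F.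
Qed.

Definition factors_through (T : finType) A : Prop :=
  exists (a : 'I_m -> {set T}) (b : 'I_n -> {set T}),
    forall i j, A i j = [exists x in a i, x \in b j].

Lemma brank_le_factors (T : finType) A : factors_through T A -> brank A <= #|T|.
Proof.
case=> a [b Aab]; pose rect x := ([set i | x \in a i], [set j | x \in b j]).
rewrite -cardsT; apply: leq_trans (leq_imset_card rect _).
apply: brank_le_cover.
apply/rectangle_coverP; split=> [_ /imsetP[x _ ->] i j|i j].
  by rewrite !inE Aab => ai bj; apply/exists_inP; exists x.
rewrite Aab => /exists_inP[x ai bj].
by exists (rect x); rewrite ?imset_f // !inE ai.
Qed.

Lemma factors_through_brank A : factors_through 'I_(brank A) A.
Proof.
have [F /rectangle_coverP[ones cov] <-] := ex_brank_cover A.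
exists (fun i => [set x : 'I_#|F| | i \in (enum_val x : rectangle m n).1]).
exists (fun j => [set x : 'I_#|F| | j \in (enum_val x : rectangle m n).2]).
move=> i j; apply/idP/exists_inP => [/cov[r rF /andP[ri rj]]|[x]].
  by exists (enum_rank_in rF r); rewrite inE enum_rankK_in.
by rewrite !inE => xi xj; apply: ones xi xj; apply: enum_valP.
Qed.

Lemma factors_through_orb (S T : finType) A B :
  factors_through S A -> factors_through T B ->
  factors_through (S + T)%type (map2_mx orb A B).
Proof.
case=> a [b Aab] [c [d Bcd]].
pose join (X : {set S}) (Y : {set T}) : {set S + T} :=
  [set x | match x with inl s => s \in X | inr t => t \in Y end].
exists (fun i => join (a i) (c i)), (fun j => join (b j) (d j)) => i j.
rewrite map2_mxE Aab Bcd.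
apply/orP/exists_inP => [[] /exists_inP[x xi xj]|[[] x]].
- by exists (inl x); rewrite inE.
- by exists (inr x); rewrite inE.
- by rewrite !inE => xi xj; left; apply/exists_inP; exists x.
- by rewrite !inE => xi xj; right; apply/exists_inP; exists x.
Qed.

Lemma brank_orb A B : brank (map2_mx orb A B) <= brank A + brank B.
Proof.
have := factors_through_brank B.
move/(factors_through_orb (factors_through_brank A))/brank_le_factors.
by rewrite card_sum !card_ord.
Qed.

Lemma covers_pairE A B C : covers [:: A; B] C <-> C = map2_mx orb A B.
Proof.
split=> [cov|-> i j].
  apply/matrixP=> i j; rewrite map2_mxE; apply/idP/orP => [/cov[E]|AB].
    by rewrite !inE => /orP[] /eqP->; [left | right].
  apply/cov; case: AB => ?; first by exists A; rewrite // !inE eqxx.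
  by exists B; rewrite // !inE eqxx orbT.
rewrite map2_mxE; split=> [/orP[] ?|[E]].
- by exists A; rewrite // !inE eqxx.
- by exists B; rewrite // !inE eqxx orbT.
- by rewrite !inE => /orP[] /eqP-> ->; rewrite ?orbT.
Qed.

End BooleanRankTheory.

Section Kronecker.

Variables m n p q : nat.
Implicit Types (A : 'M[bool]_(m, n)) (B : 'M[bool]_(p, q)).

Lemma tens_boolE A B i j k l :
  (A *t B)%R (mxtens_index (i, j)) (mxtens_index (k, l)) = A i k && B j l.
Proof. exact: tensmxE. Qed.

Lemma factors_through_tens (S T : finType) A B :
  factors_through S A -> factors_through T B ->
  factors_through (S * T)%type (A *t B)%R.
Proof.
case=> a [b Aab] [c [d Bcd]].
exists (fun i => setX (a (mxtens_unindex i).1) (c (mxtens_unindex i).2)).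
exists (fun j => setX (b (mxtens_unindex j).1) (d (mxtens_unindex j).2)).
move=> i j; case: i / mxtens_indexP => i1 i2; case: j / mxtens_indexP => j1 j2.
rewrite !mxtens_indexK tens_boolE Aab Bcd.
apply/andP/exists_inP => [[/exists_inP[s si sj] /exists_inP[t ti tj]]|[[s t]]].
  by exists (s, t); rewrite inE /= ?si ?sj.
rewrite !inE /= => /andP[si ti] /andP[sj tj].
by split; apply/exists_inP; [exists s | exists t].
Qed.

Lemma brank_tens A B : brank (A *t B)%R <= brank A * brank B.
Proof.
have := factors_through_brank B.
move/(factors_through_tens (factors_through_brank A))/brank_le_factors.
by rewrite card_prod !card_ord.
Qed.

(* Any two two-element subsets of [{1, 2, 3}] meet after applying the
   transposition of [2] and [3] to the second one. *)
Lemma tens_coverE A A1 A2 A3 B B1 B2 B3 :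
  [/\ covers [:: A1; A2] A, covers [:: A1; A3] A & covers [:: A2; A3] A] ->
  [/\ covers [:: B1; B2] B, covers [:: B1; B3] B & covers [:: B2; B3] B] ->
  (A *t B = map2_mx orb (map2_mx orb (A1 *t B1) (A2 *t B3)) (A3 *t B2))%R.
Proof.
case=> /covers_pairE/matrixP A12 /covers_pairE/matrixP A13.
move=> /covers_pairE/matrixP A23.
case=> /covers_pairE/matrixP B12 /covers_pairE/matrixP B13.
move=> /covers_pairE/matrixP B23.
apply/matrixP=> i j.
case: i / mxtens_indexP => i1 i2; case: j / mxtens_indexP => j1 j2.
move: (A12 i1 j1) (A13 i1 j1) (A23 i1 j1) (B12 i2 j2) (B13 i2 j2) (B23 i2 j2).
rewrite tens_boolE !map2_mxE !tens_boolE.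
case: (A i1 j1) (A1 i1 j1) (A2 i1 j1) (A3 i1 j1) => [] [] [] [] //.
all: by case: (B i2 j2) (B1 i2 j2) (B2 i2 j2) (B3 i2 j2) => [] [] [] [].
Qed.

Lemma brank_tens_coverable A B a1 a2 a3 b1 b2 b3 :
  coverable a1 a2 a3 A -> coverable b1 b2 b3 B ->
  brank (A *t B)%R <= a1 * b1 + a2 * b3 + a3 * b2.
Proof.
move=> [A1 [A2 [A3 [[rA1 rA2 rA3] coverA]]]].
move=> [B1 [B2 [B3 [[rB1 rB2 rB3] coverB]]]].
rewrite (tens_coverE coverA coverB).
have tens_le k l (C : 'M_(m, n)) (D : 'M_(p, q)) :
    brank C <= k -> brank D <= l -> brank (C *t D)%R <= k * l.
  by move=> rC rD; apply: leq_trans (brank_tens C D) (leq_mul rC rD).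
apply: leq_trans (brank_orb _ _) _; apply: leq_add (tens_le _ _ _ _ rA3 rB2).
by apply: leq_trans (brank_orb _ _) _; apply: leq_add; apply: tens_le.
Qed.

End Kronecker.

(** * The matrices [cmx n] *)

Section Sigma.

Implicit Types n k : nat.

Lemma sigma_le n k : n <= 'C(k, uphalf k) -> sigma n <= k.
Proof. by rewrite /sigma; case: ex_minnP => s _; apply. Qed.

Lemma leq_bin_sigma n : n <= 'C(sigma n, uphalf (sigma n)).
Proof. by rewrite /sigma; case: ex_minnP. Qed.

Lemma sigma_gt4 n : 6 < n -> 4 < sigma n.
Proof.
move=> n7; have := leq_trans n7 (leq_bin_sigma n).
by case: (sigma n) => [|[|[|[|[|]]]]].
Qed.

End Sigma.

Lemma sigma_le_brank_cmx n : sigma n <= brank (cmx n).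
Proof.
have [a [b cmxE]] := factors_through_brank (cmx n).
apply: sigma_le; rewrite -{1}(card_ord n) -{1 2}(card_ord (brank (cmx n))).
apply: (sperner (a := a)) => i j aij; apply/eqP/negPn/negP => ij.
have /exists_inP[x ai bj] : [exists x in a i, x \in b j] by rewrite -cmxE mxE.
have : cmx n j j.
  by rewrite cmxE; apply/exists_inP; exists x => //; apply: (subsetP aij).
by rewrite mxE eqxx.
Qed.

Definition noninclmx m n (T : finType) (a : 'I_m -> {set T})
    (b : 'I_n -> {set T}) : 'M[bool]_(m, n) :=
  (\matrix_(i, j) ~~ (a i \subset b j))%R.

Lemma brank_noninclmx m n (T : finType) (a : 'I_m -> {set T})
    (b : 'I_n -> {set T}) :
  brank (noninclmx a b) <= #|T|.
Proof.
apply: brank_le_factors; exists a, (fun j => ~: b j) => i j; rewrite mxE.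
by apply/subsetPn/exists_inP => -[x xi xj]; exists x; rewrite // inE in xj *.
Qed.

Definition rectmx m n (L : {set 'I_m}) (U : {set 'I_n}) : 'M[bool]_(m, n) :=
  (\matrix_(i, j) ((i \in L) && (j \in U)))%R.

Lemma brank_rectmx m n (L : {set 'I_m}) (U : {set 'I_n}) :
  brank (rectmx L U) <= 1.
Proof.
rewrite -card_unit; apply: brank_le_factors.
exists (fun i => [set _ | i \in L]), (fun j => [set _ | j \in U]) => i j.
rewrite mxE; apply/andP/exists_inP => [[iL jU]|[x]]; last by rewrite !inE.
by exists tt; rewrite inE.
Qed.

Lemma coverable_cmx_noninclmx n (S T : finType) (a : 'I_n -> {set S})
    (b : 'I_n -> {set T}) (D : 'M[bool]_n) r :
  brank D <= r -> (forall i, D i i = false) ->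
  (forall i j, i != j -> a i \subset a j -> D i j) ->
  (forall i j, i != j -> b i \subset b j -> D i j) ->
  (forall i j, i != j -> a i \subset a j -> ~~ (b i \subset b j)) ->
  coverable #|S| #|T| r (cmx n).
Proof.
move=> rD D0 aD bD ab; exists (noninclmx a a), (noninclmx b b), D.
split; first by split=> //; apply: brank_noninclmx.
split; apply/covers_pairE/matrixP => i j; rewrite map2_mxE !mxE.
all: case: eqVneq => [->|ij] /=; rewrite ?subxx ?D0 //.
all: apply/esym; rewrite -implybE; apply/implyP.
- exact: ab.
- exact: aD.
- exact: bD.
Qed.

Lemma card_two_levels (T : finType) h :
  #|[set A : {set T} | h <= #|A| <= h.+1]| = 'C(#|T|.+1, h.+1).
Proof.
rewrite binS -!card_draws -cardsUI.
rewrite (_ : _ :&: _ = set0) ?cards0 ?addn0.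
  by apply: eq_card => A; rewrite !inE; lia.
by apply/setP=> A; rewrite !inE; lia.
Qed.

Lemma ex_two_level_family n (T : finType) h : n <= 'C(#|T|.+1, h.+1) ->
  exists2 a : 'I_n -> {set T}, injective a & forall i, h <= #|a i| <= h.+1.
Proof.
rewrite -card_two_levels => le_n.
exists (enum_val \o widen_ord le_n) => [i j /enum_val_inj[]|i].
  exact: val_inj.
by have := enum_valP (widen_ord le_n i); rewrite inE.
Qed.

Lemma two_level_sub (I : eqType) (T : finType) (a : I -> {set T}) h i j :
  injective a -> (forall i, h <= #|a i| <= h.+1) ->
  i != j -> a i \subset a j -> #|a i| = h /\ #|a j| = h.+1.
Proof.
move=> a_inj a_levels ij sub_ij.
have : a i \proper a j by rewrite properEneq sub_ij (inj_eq a_inj) ij.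
by move/proper_card; have := a_levels i; have := a_levels j; lia.
Qed.

Lemma coverable_cmx n m : 4 <= m -> n <= 'C(m.+1, uphalf m) ->
  coverable m m 1 (cmx n).
Proof.
move=> m4; pose h := (uphalf m).-1.
have hS : uphalf #|'I_m| = h.+1 by rewrite card_ord; lia.
rewrite -(card_ord m) hS => /ex_two_level_family[a a_inj a_levels].
have [rho [rho_inj card_rho rho_id cardI_rho]] :=
  ex_middle_level_permutation 'I_m.
pose b i := rho (a i).
have b_inj : injective b by move=> i j /rho_inj/a_inj.
have b_levels i : h <= #|b i| <= h.+1 by rewrite card_rho.
pose lower := [set i | #|a i| == h]; pose upper := [set i | #|a i| == h.+1].
apply: (coverable_cmx_noninclmx (brank_rectmx lower upper) (a := a) (b := b)).
- by move=> i; rewrite mxE !inE; lia.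
- move=> i j ij /(two_level_sub a_inj a_levels ij)[ci cj].
  by rewrite mxE !inE ci cj !eqxx.
- move=> i j ij /(two_level_sub b_inj b_levels ij).
  by rewrite !card_rho mxE !inE => -[-> ->]; rewrite !eqxx.
move=> i j ij ab_ij; have [ci cj] := two_level_sub a_inj a_levels ij ab_ij.
have bi : b i = a i by rewrite /b rho_id // ci hS; lia.
apply/negP; rewrite bi => bij.
have : a i \subset a j :&: rho (a j) by rewrite subsetI ab_ij.
by move/subset_leq_card; rewrite cardI_rho ?hS // ci card_ord; lia.
Qed.

Lemma coverable_cmx_sigma n : 7 <= n ->
  coverable (sigma n - 1) (sigma n - 1) 1 (cmx n).
Proof.
move=> /sigma_gt4; have := leq_bin_sigma n; case: (sigma n) => // m le_n m4.
rewrite subn1; apply: coverable_cmx => //; rewrite -bin_sub; last by lia.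
by rewrite (_ : m.+1 - uphalf m = uphalf m.+1) //; lia.
Qed.

Theorem theorem5 :
  (forall n : nat, 7 <= n ->
     coverable (sigma n - 1) (sigma n - 1) 1 (cmx n)) /\
  (forall n m : nat, 7 <= n -> 7 <= m ->
     brank (cmx n *t cmx m)%R < brank (cmx n) * brank (cmx m)).
Proof.
split=> [|n m n7 m7]; first exact: coverable_cmx_sigma.
apply: leq_trans (leq_mul (sigma_le_brank_cmx n) (sigma_le_brank_cmx m)).
have := brank_tens_coverable (coverable_cmx_sigma n7) (coverable_cmx_sigma m7).
by have := sigma_gt4 n7; have := sigma_gt4 m7; nia.
Qed.
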